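(* Let $p>3$ be a prime and let $x=r/m$, where $0<r<m$ are integers with $m$ prime to $p$. Then $$\sum_{k=1}^{p-1} {(x)_k(1-x)_k\over (1)_k^2}\cdot{1\over k}\equiv Q_p(x) +{1\over 2}p\,Q_p(x)^2\pmod{p^2},$$ $$\sum_{k=1}^{p-1} {(x)_k(1-x)_k\over (1)_k^2}\cdot{1\over k^2}\equiv -{1\over 2}Q_p(x)^2\pmod{p}.$$
   Context: $(y)_n=y(y+1)\cdots(y+n-1)$ denotes the Pochhammer symbol. For an integer $m$ and a rational $a$ whose denominator is prime to $m$, $[a]_m$ denotes the unique representative of $a$ modulo $m$ in $\{0,1,\dots,m-1\}$. The Pochhammer quotient is $$Q_p(x)={1\over p}\left(1-{(x)_p(1-x)_p\over (1)^2_p}\cdot {m^2\over [r/p]_m[-r/p]_m}\right),$$ which is a $p$-integral rational number. Congruences between rational numbers modulo $p^j$ mean that the difference is a rational number whose numerator is divisible by $p^j$ and whose denominator is prime to $p$. *)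

(* Defs.v *)
From HB Require Import structures.
From mathcomp Require Import all_boot all_order all_algebra.
Set Implicit Arguments. Unset Strict Implicit. Unset Printing Implicit Defensive.
Import Order.TTheory GRing.Theory Num.Theory.
Local Open Scope ring_scope.

Definition poch (y : rat) (n : nat) : rat := \prod_(i < n) (y + i%:R).

(* [a]_m : the representative of the rational a modulo m in {0,...,m-1},
   i.e. the t with a = t (mod m); meaningful when denq a is prime to m
   (then it is unique).  Defaults to 0 if none exists. *)
Definition modrep (m : nat) (a : rat) : nat :=
  match [pick t : 'I_m | ((m%:Z) %| (numq a - (nat_of_ord t)%:Z * denq a))%Z] with
  | Some t => nat_of_ord t
  | None => 0%N
  end.

Definition Qp (p r m : nat) : rat :=
  let x : rat := r%:R / m%:R in
  p%:R^-1 * (1 - poch x p * poch (1 - x) p / (poch 1 p) ^+ 2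
                 * ((m%:R) ^+ 2 / ((modrep m (r%:R / p%:R))%:R
                                   * (modrep m (- (r%:R / p%:R)))%:R))).

Definition ratcong (p j : nat) (a b : rat) : Prop :=
  ((p ^ j)%:Z %| numq (a - b))%Z /\ coprime p `|denq (a - b)|%N.

(* Main.v *)
Require Import Defs.
From HB Require Import structures.
From mathcomp Require Import all_boot all_order all_algebra.
From mathcomp Require Import ring zify.
Import Order.TTheory GRing.Theory Num.Theory.
Local Open Scope ring_scope.
Set Implicit Arguments. Unset Strict Implicit.

(* Write T_k(x) = (x)_k (1-x)_k / k!^2 (hyp_sym), U_k(x) = (x)_k (-x)_k / k!^2
   (hyp_opp), and F, G (hsum1, hsum2) for the sums of T_k / k and T_k / k^2.
   From x T_k(x) = U_k(x) (x - k) and x T_k(x+1) = U_k(x) (x + k) one gets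
   x (F(x+1) - F(x)) = 2 sum_{0<k<p} U_k(x), which telescopes to
   2 ((1+x)_{p-1} (1-x)_{p-1} / (p-1)!^2 - 1), and x (G(x+1) - G(x)) = F(x+1) + F(x).
   If t = [r/p]_m and y = t/m, then x = p y - a with 0 <= a < p.  Descending from
   p y to p y - a yields F(x) = h mod p^2 and G(x) = - h^2 / 2 mod p, where
   h = 2 sum_{0<i<=a} 1/(p y - i) (harm); the start values vanish because
   sum_{0<k<p} 1/k^2 = 0 mod p.  The first-order relation between T_p(x) and
   T_p(x+1) gives, by the same descent,
   1 - p Q_p(x) = T_p(x) / (y (1-y)) = 1 - p h + p^2 h^2 / 2 mod p^3,
   that is, Q_p(x) = h - p h^2 / 2 mod p^2. *)

(** * The subring of p-integral rationals *)

Definition pint (p : nat) : {pred rat} := fun a => coprime p `|denq a|.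

(** For d nonzero the reduced denominator divides d: it divides [numq * d] and is coprime to
    [numq]. *)
Lemma pint_frac (p : nat) (n d : int) :
  coprime p `|d| -> n%:~R / d%:~R \in pint p.
Proof.
move=> cpd; rewrite /pint /in_mem /=.
have [->|d0] := eqVneq d 0.
  by rewrite mulr0z invr0 mulr0 coprimen1.
apply: coprime_dvdr cpd; rewrite -dvdzE.
have: (denq (n%:~R / d%:~R) %| numq (n%:~R / d%:~R) * d)%Z.
  apply/dvdzP; exists n; apply/(@intr_inj rat).
  rewrite !rmorphM /= numqE.
  field; by rewrite intr_eq0.
by rewrite Gauss_dvdzr // coprimezE coprime_sym coprime_num_den.
Qed.

Fact pint_subring_closed p : subring_closed (pint p).
Proof.
have frac a : a \in pint p -> coprime p `|denq a| by [].
split=> [|a b /frac pa /frac pb|a b /frac pa /frac pb].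
- by rewrite /pint /in_mem /= coprimen1.
- have -> : a - b = (numq a * denq b - numq b * denq a)%:~R / (denq a * denq b)%:~R.
    rewrite rmorphB !rmorphM /= -{1}[a]divq_num_den -{1}[b]divq_num_den.
    field; by rewrite !intr_eq0 !denq_neq0.
  by apply: pint_frac; rewrite abszM coprimeMr pa pb.
have -> : a * b = (numq a * numq b)%:~R / (denq a * denq b)%:~R.
  rewrite !rmorphM /= -{1}[a]divq_num_den -{1}[b]divq_num_den.
  field; by rewrite !intr_eq0 !denq_neq0.
by apply: pint_frac; rewrite abszM coprimeMr pa pb.
Qed.

HB.instance Definition _ p := GRing.isSubringClosed.Build rat (pint p) (pint_subring_closed p).

Lemma pint_natV p n : coprime p n -> n%:R^-1 \in pint p.
Proof. by move=> cpn; have := @pint_frac p 1 n%:Z cpn; rewrite mul1r. Qed.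

Lemma pint_natV_lt p n : prime p -> (0 < n < p)%N -> n%:R^-1 \in pint p.
Proof.
by move=> pp /andP[n0 np]; apply: pint_natV; rewrite prime_coprime // gtnNdvd.
Qed.

Lemma prime_inv_notin_pint p : prime p -> p%:R^-1 \notin pint p.
Proof.
move=> pp; rewrite /pint /in_mem /= (_ : p%:R^-1 = (p%:~R)^-1 :> rat) //.
rewrite denqVz; last by have := prime_gt0 pp; lia.
by rewrite absz_nat /coprime gcdnn; have := prime_gt1 pp; lia.
Qed.

(** Otherwise 1/p = b/i would be p-integral. *)
Lemma nat_neq_prime_mul p i b : prime p -> (0 < i < p)%N -> b \in pint p ->
  i%:R <> p%:R * b :> rat.
Proof.
move=> pp ip pb e; have := prime_inv_notin_pint pp; apply/negP; rewrite negbK.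
have iV := pint_natV_lt pp ip.
have p0 : p%:R != 0 :> rat by rewrite pnatr_eq0; have := prime_gt0 pp; lia.
have i0 : i%:R != 0 :> rat by rewrite pnatr_eq0; lia.
suff -> : p%:R^-1 = b * i%:R^-1 :> rat by rewrite rpredM.
by apply: (mulfI p0); rewrite mulrA -e !mulfV.
Qed.

(** If p divided the numerator of the sum, then the sum, and with it i, would be p times a
    p-integral number. *)
Lemma pint_unit p i c : prime p -> (0 < i < p)%N -> c \in pint p ->
  i%:R + p%:R * c != 0 /\ (i%:R + p%:R * c)^-1 \in pint p.
Proof.
move=> pp ip pc; set v := _ + _.
have pv : v \in pint p by rewrite rpredD ?rpredM ?rpred_nat.
have notp b : b \in pint p -> v != p%:R * b.
  move=> pb; apply/eqP => e.
  apply: (@nat_neq_prime_mul p i (b - c)) => //; first by rewrite rpredB.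
  by rewrite mulrBr -e /v addrK.
split; first by have := notp 0 (rpred0 _); rewrite mulr0.
rewrite -[v]divq_num_den invfM invrK mulrC; apply: pint_frac.
rewrite prime_coprime //; apply/negP => /dvdnP[k ek].
have /negP := notp ((k%:Z * sgz (numq v))%:~R / (denq v)%:~R)
  (@pint_frac p _ _ pv).
apply; rewrite -{1}[v]divq_num_den {1}[numq v]intEsg ek PoszM.
by rewrite !rmorphM /=; apply/eqP; ring.
Qed.

(** The denominator of c is prime to p^j, so it cancels from the divisibility of numerators. *)
Lemma ratcongP p j (a b c : rat) : prime p -> c \in pint p ->
  a - b = p%:R ^+ j * c -> ratcong p j a b.
Proof.
move=> pp pc e; split; last first.
  change (a - b \in pint p).
  by rewrite e rpredM ?rpredX ?rpred_nat.
have cpc : coprimez (p ^ j)%:Z (denq c).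
  by rewrite coprimezE absz_nat coprimeXl.
rewrite -(Gauss_dvdzl _ cpc); apply/dvdzP; exists (numq c * denq (a - b)).
apply/(@intr_inj rat); rewrite !rmorphM /= !numqE e
  (_ : (p ^ j)%N%:~R = p%:R ^+ j); last by rewrite -natrX.
by ring.
Qed.

Ltac pint_tac :=
  repeat match goal with
  | H : is_true (?a \in _) |- is_true (?a \in _) => exact: H
  | |- is_true (_ - _ \in _) => apply: rpredB
  | |- is_true (- _ \in _) => apply: rpredN
  | |- is_true (_ + _ \in _) => apply: rpredD
  | |- is_true (_ * _ \in _) => apply: rpredM
  | |- is_true (_ ^+ _ \in _) => apply: rpredX
  | |- is_true (0 \in _) => apply: rpred0
  | |- is_true (1 \in _) => apply: rpred1
  | |- is_true (_%:R \in _) => apply: rpred_nat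
  end.

(** * Pochhammer symbols and hypergeometric terms *)

Lemma pochS y n : poch y n.+1 = poch y n * (y + n%:R).
Proof. exact: big_ord_recr. Qed.

Lemma poch_recl y n : poch y n.+1 = y * poch (y + 1) n.
Proof.
rewrite /poch big_ord_recl addr0; congr (_ * _); apply: eq_bigr => i _.
by rewrite -addrA -natr1 [1 + _]addrC.
Qed.

Lemma poch1 n : poch 1 n = n`!%:R.
Proof.
elim: n => [|n IH]; first by rewrite /poch big_ord0.
by rewrite pochS IH factS mulnC natrM -nat1r.
Qed.

Lemma poch_dvd p y n i c : y \in pint p -> c \in pint p -> (i < n)%N ->
  y + i%:R = p%:R * c -> exists2 d, d \in pint p & poch y n = p%:R * d.
Proof.
move=> py pc lin e; rewrite /poch (bigD1 (Ordinal lin)) //= e.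
exists (c * \prod_(j < n | j != Ordinal lin) (y + j%:R)); last by rewrite mulrA.
by rewrite rpredM // rpred_prod // => j _; rewrite rpredD ?rpred_nat.
Qed.

Lemma pint_factV p n : prime p -> (n < p)%N -> n`!%:R^-1 \in pint p.
Proof.
move=> pp; elim: n => [|n IH] np; first by rewrite fact0 invr1 rpred1.
by rewrite factS natrM invfM rpredM ?IH ?pint_natV_lt //; lia.
Qed.

Definition hyp_sym x k : rat := poch x k * poch (1 - x) k / poch 1 k ^+ 2.
Definition hyp_opp x k : rat := poch x k * poch (- x) k / poch 1 k ^+ 2.
(** This is the product of 1 - x^2/k^2 over 0 < k <= n, a partial product of sin(pi x)/(pi x). *)
Definition hyp_prod x n : rat := poch (1 + x) n * poch (1 - x) n / poch 1 n ^+ 2.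

Lemma hyp_symS x k :
  hyp_sym x k.+1 = hyp_sym x k * (x + k%:R) * (1 - x + k%:R) / k.+1%:R ^+ 2.
Proof. by rewrite /hyp_sym !pochS nat1r exprMn invfM; ring. Qed.

(** Both -x (1-x)_k and (-x)_k (k-x) are (-x)_{k+1}. *)
Lemma mul_hyp_sym x k : x * hyp_sym x k = hyp_opp x k * (x - k%:R).
Proof.
rewrite /hyp_sym /hyp_opp; have : - x * poch (1 - x) k = poch (- x) k * (k%:R - x).
  by rewrite [k%:R - x]addrC -pochS poch_recl [- x + 1]addrC.
move=> e; transitivity (- (poch x k * (- x * poch (1 - x) k) / poch 1 k ^+ 2)).
  by ring.
by rewrite e; ring.
Qed.

Lemma mul_hyp_symD1 x k : x * hyp_sym (x + 1) k = hyp_opp x k * (x + k%:R).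
Proof.
rewrite /hyp_sym /hyp_opp (_ : 1 - (x + 1) = - x); last by ring.
have : x * poch (x + 1) k = poch x k * (x + k%:R) by rewrite -pochS poch_recl.
by move=> e; rewrite !mulrA e; ring.
Qed.

(** U_{n+1}(x) is -x^2/(n+1)^2 times [hyp_prod x n], which is the increment of the product. *)
Lemma sum_hyp_opp x n : \sum_(0 <= k < n.+1) hyp_opp x k = hyp_prod x n.
Proof.
elim: n => [|n IH]; first by rewrite big_nat1 /hyp_opp /hyp_prod /poch !big_ord0.
rewrite big_nat_recr //= IH /hyp_opp /hyp_prod ![poch _ n.+1 in X in _ + X / _]poch_recl.
rewrite !pochS [- x + 1]addrC [x + 1]addrC.
have nz : poch 1 n != 0 by rewrite poch1 pnatr_eq0 -lt0n fact_gt0.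
have nz1 : 1 + n%:R != 0 :> rat by rewrite nat1r pnatr_eq0.
by field; rewrite nz nz1.
Qed.

(** * The two sums and their difference equations in x *)

Definition hsum1 p x : rat := \sum_(1 <= k < p) hyp_sym x k / k%:R.
Definition hsum2 p x : rat := \sum_(1 <= k < p) hyp_sym x k / k%:R ^+ 2.

Lemma hsum1_diff p x : (0 < p)%N ->
  x * (hsum1 p (x + 1) - hsum1 p x) = 2 * (hyp_prod x p.-1 - 1).
Proof.
(* [sum_hyp_opp] starts at k = 0; its term U_0 = 1 accounts for the -1. *)
case: p => // p _; rewrite -sum_hyp_opp big_ltn //.
rewrite (_ : hyp_opp x 0 = 1); last by rewrite /hyp_opp /poch !big_ord0; field.
rewrite [1 + _]addrC addrK /hsum1 -sumrB !mulr_sumr; apply: eq_big_nat => k /andP[k0 _].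
have nz : k%:R != 0 :> rat by rewrite pnatr_eq0; lia.
by rewrite -mulrBl mulrA mulrBr mul_hyp_symD1 mul_hyp_sym; field.
Qed.

(** Termwise, x (T_k(x+1) - T_k(x)) = 2 k U_k(x) and T_k(x+1) + T_k(x) = 2 U_k(x). *)
Lemma hsum2_diff p x : x != 0 ->
  x * (hsum2 p (x + 1) - hsum2 p x) = hsum1 p (x + 1) + hsum1 p x.
Proof.
move=> x0; rewrite /hsum2 /hsum1 -sumrB mulr_sumr -big_split /=.
apply: eq_big_nat => k /andP[k0 _].
have nz : k%:R != 0 :> rat by rewrite pnatr_eq0; lia.
have e : hyp_sym (x + 1) k - hyp_sym x k = 2 * k%:R * hyp_opp x k / x.
  by apply: (mulfI x0); rewrite mulrBr mul_hyp_symD1 mul_hyp_sym; field.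
have e1 : hyp_sym (x + 1) k + hyp_sym x k = 2 * hyp_opp x k.
  by apply: (mulfI x0); rewrite mulrDr mul_hyp_symD1 mul_hyp_sym; ring.
by rewrite -mulrBl -mulrDl e e1; field; rewrite x0 nz.
Qed.

(** * Congruences with an explicit p-integral cofactor, and expansions at p y *)

Definition eqmod p j (a b : rat) : Prop := exists2 c, c \in pint p & a = b + p%:R ^+ j * c.

(** The factor p y splits off (p y)_k; modulo p the rest of it is (k-1)! and (1 - p y)_k is k!. *)
Lemma hyp_sym_mulp p y k : prime p -> y \in pint p -> (0 < k < p)%N ->
  eqmod p 2 (hyp_sym (p%:R * y) k) (p%:R * y / k%:R).
Proof.
move=> pp py; case: k => // k; elim: k => [|k IH] kp.
  exists (- y ^+ 2); first by rewrite rpredN rpredX.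
  by rewrite /hyp_sym !pochS /poch !big_ord0; field.
have [|c pc e] := IH _; first lia.
have nz : k.+1%:R != 0 :> rat by rewrite pnatr_eq0.
have nz1 : k.+2%:R != 0 :> rat by rewrite pnatr_eq0.
have pV := pint_natV_lt pp kp.
have pV1 : k.+1%:R^-1 \in pint p by apply: pint_natV_lt => //; lia.
exists ((y ^+ 2 / k.+1%:R * (1 - p%:R * y) +
    c * (k.+1%:R + p%:R * y) * (1 - p%:R * y + k.+1%:R)) * (k.+2%:R^-1) ^+ 2).
  by pint_tac.
rewrite hyp_symS e -[k.+2%:R]natr1 in nz1 *.
by field; rewrite !nat1r nz nz1.
Qed.

(** In the expanded product of the 1 - p^2 y^2/k^2, all further terms are divisible by p^4. *)
Lemma hyp_prod_mulp p y n : prime p -> y \in pint p -> (n < p)%N ->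
  eqmod p 3 (hyp_prod (p%:R * y) n) (1 - p%:R ^+ 2 * y ^+ 2 * \sum_(1 <= k < n.+1) (k%:R^-1) ^+ 2).
Proof.
move=> pp py; elim: n => [|n IH] np.
  exists 0; first exact: rpred0.
  by rewrite /hyp_prod /poch big_geq // !big_ord0; field.
have [|c pc e] := IH _; first lia.
have nz : n.+1%:R != 0 :> rat by rewrite pnatr_eq0.
have pV : n.+1%:R^-1 \in pint p by apply: pint_natV_lt.
have pS : \sum_(1 <= k < n.+1) (k%:R^-1 : rat) ^+ 2 \in pint p.
  by rewrite big_nat; apply: rpred_sum => k kn; rewrite rpredX // pint_natV_lt //; lia.
rewrite big_nat_recr //=; move: (\sum_(_ <= k < _) _) => S in e pS *.
have -> : hyp_prod (p%:R * y) n.+1 =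
    hyp_prod (p%:R * y) n * (1 - p%:R ^+ 2 * y ^+ 2 * (n.+1%:R^-1) ^+ 2).
  rewrite /hyp_prod !pochS nat1r exprMn invfM.
  transitivity (poch (1 + p%:R * y) n * poch (1 - p%:R * y) n / poch 1 n ^+ 2 *
      ((n.+1%:R ^+ 2 - (p%:R * y) ^+ 2) / n.+1%:R ^+ 2)).
    by rewrite -natr1; ring.
  by congr (_ * _); field; rewrite nat1r.
exists (c * (1 - p%:R ^+ 2 * y ^+ 2 * (n.+1%:R^-1) ^+ 2) + p%:R * y ^+ 4 * S * (n.+1%:R^-1) ^+ 2).
  by pint_tac.
by rewrite e; ring.
Qed.

(** Reindexing by x -> 2x gives S = S/4 for the sum S over the field, so 3 S = 0, and 2 and 3 are
    invertible. *)
Lemma sum_inv_sqr_Fp p : prime p -> (3 < p)%N ->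
  \sum_(1 <= k < p) ((k%:R : 'F_p)^-1) ^+ 2 = 0.
Proof.
move=> pp p3.
have nz k : (0 < k < p)%N -> (k%:R : 'F_p) != 0.
  by move=> kp; rewrite -(dvdn_pcharf (pchar_Fp pp)) gtnNdvd //; lia.
have S0 : \sum_(x : 'F_p) (x^-1) ^+ 2 = 0.
  have n2 : (2 : 'F_p) != 0 by apply: nz; lia.
  have n3 : (3 : 'F_p) != 0 by apply: nz; lia.
  have := reindex_inj (mulfI n2) (P := xpredT)
    (F := fun x : 'F_p => (x^-1) ^+ 2) (op := +%R) (x := 0).
  under [X in _ = X -> _]eq_bigr do rewrite invfM exprMn.
  rewrite -mulr_sumr; set S := \sum_i _ => e.
  apply: (mulfI n3); rewrite mulr0.
  have -> : 3 * S = 4 * (S - (2^-1) ^+ 2 * S) by field.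
  by rewrite -e subrr mulr0.
have : \sum_(0 <= k < p) ((k%:R : 'F_p)^-1) ^+ 2 = 0.
  (* The bound is generalized to q because the cardinal built into ['F_p] equals p only
     propositionally. The index 0 is harmless, since 0^-1 = 0. *)
  apply: etrans S0; have : forall q, q = (Zp_trunc (pdiv p)).+2 ->
      \sum_(0 <= k < q) ((k%:R : 'F_p)^-1) ^+ 2 = \sum_(x : 'F_p) (x^-1) ^+ 2.
    by move=> q ->; rewrite big_mkord; apply: eq_bigr => i _; rewrite natr_Zp.
  by apply; rewrite Fp_cast.
by rewrite big_ltn ?prime_gt0 // invr0 expr0n add0r.
Qed.

(** Multiplying by (p-1)!^2 turns the sum into a natural number N, whose image in ['F_p]
    vanishes. *)
Lemma sum_inv_sqr p : prime p -> (3 < p)%N ->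
  eqmod p 1 (\sum_(1 <= k < p) (k%:R^-1) ^+ 2) 0.
Proof.
move=> pp p3; pose f := (p.-1)`!; pose N := (\sum_(1 <= k < p) (f %/ k) ^ 2)%N.
have fk k : (0 < k < p)%N -> (f %/ k * k = f)%N.
  by move=> kp; rewrite divnK // dvdn_fact //; lia.
have f0 : (f%:R : rat) != 0 by rewrite pnatr_eq0 -lt0n fact_gt0.
have /dvdnP[M eM] : (p %| N)%N.
  rewrite (dvdn_pcharf (pchar_Fp pp)) /N natr_sum.
  rewrite (eq_big_nat _ _ (F2 := fun k => (f%:R : 'F_p) ^+ 2 * (k%:R^-1) ^+ 2)).
    by rewrite -mulr_sumr sum_inv_sqr_Fp // mulr0.
  move=> k kp; rewrite natrX -exprMn; congr (_ ^+ 2).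
  rewrite -{2}(fk k kp) natrM mulfK // -(dvdn_pcharf (pchar_Fp pp)) gtnNdvd //; lia.
exists (M%:R * (f%:R^-1) ^+ 2).
  have : f%:R^-1 \in pint p by apply: pint_factV => //; have := prime_gt0 pp; lia.
  by move=> pf; pint_tac.
have -> : \sum_(1 <= k < p) (k%:R^-1 : rat) ^+ 2 = N%:R * (f%:R^-1) ^+ 2.
  rewrite /N natr_sum mulr_suml; apply: eq_big_nat => k kp.
  have k0 : (k%:R : rat) != 0 by rewrite pnatr_eq0; lia.
  rewrite natrX -exprMn; congr (_ ^+ 2); apply: (mulfI f0).
  by rewrite mulrCA mulfV // mulr1 -{1}(fk k kp) natrM mulfK.
by rewrite eM natrM; ring.
Qed.

Lemma pint_half p : prime p -> (3 < p)%N -> 2^-1 \in pint p.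
Proof. by move=> pp p3; apply: pint_natV_lt => //; lia. Qed.

Lemma unit_shift p c i : prime p -> c \in pint p -> (0 < i < p)%N ->
  p%:R * c - i%:R != 0 /\ (p%:R * c - i%:R)^-1 \in pint p.
Proof.
move=> pp pc ip; have [|u0 uV] := pint_unit pp ip (c := - c); first by rewrite rpredN.
have -> : p%:R * c - i%:R = - (i%:R + p%:R * - c) by ring.
by rewrite oppr_eq0 invrN rpredN.
Qed.

(** * Descent from p y to p y - a *)

Section Chain.
Context (p : nat) (y : rat).
Hypotheses (pp : prime p) (p3 : (3 < p)%N) (py : y \in pint p).
Let P : rat := p%:R.

Definition harm (a : nat) : rat := 2 * \sum_(1 <= i < a.+1) (P * y - i%:R)^-1.

Lemma harm0 : harm 0 = 0.
Proof. by rewrite /harm big_geq // mulr0. Qed.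

Lemma harmS a : harm a.+1 = harm a + 2 / (P * y - a.+1%:R).
Proof. by rewrite /harm big_nat_recr //= mulrDr. Qed.

Lemma pint_harm a : (a < p)%N -> harm a \in pint p.
Proof.
move=> ap; rewrite rpredM ?rpred_nat // big_nat; apply: rpred_sum => i ia.
by apply: (unit_shift pp _ _).2 => //; lia.
Qed.

(** Each of (1+x)_{p-1} and (1-x)_{p-1} contains a multiple of p: the factor of index i-1 is p y,
    that of index p-1-i is p (1-y). *)
Lemma hyp_prod_shift i : (0 < i < p)%N -> eqmod p 2 (hyp_prod (P * y - i%:R) p.-1) 0.
Proof.
move=> ip; set x := _ - _.
have px : x \in pint p by rewrite /x /P; pint_tac.
have p1x : 1 + x \in pint p by pint_tac.
have p1x' : 1 - x \in pint p by pint_tac.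
have py1 : 1 - y \in pint p by pint_tac.
have [||c pc ec] := @poch_dvd p (1 + x) p.-1 i.-1 y p1x py; first lia.
  by rewrite /x -[in i%:R](prednK (n := i)) -?natr1; [ring|lia].
have [||d pd ed] := @poch_dvd p (1 - x) p.-1 (p.-1 - i) (1 - y) p1x' py1; first lia.
  rewrite natrB; last lia.
  by rewrite /x /P -[p in p%:R](prednK (n := p)) -?natr1; [ring|lia].
have pf := @pint_factV p p.-1 pp; rewrite -poch1 in pf.
exists (c * d * ((poch 1 p.-1)^-1) ^+ 2).
  by have {}pf := pf ltac:(lia); pint_tac.
by rewrite /hyp_prod ec ed exprVn; ring.
Qed.

(** By [hyp_sym_mulp] the sum is p y times the sum of the 1/k^2, which brings the second factor
    p. *)
Lemma hsum1_mulp : eqmod p 2 (hsum1 p (P * y)) 0.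
Proof.
have [c pc ec] := sum_inv_sqr pp p3.
suff [d pd ed] : eqmod p 2 (hsum1 p (P * y)) (P * y * \sum_(1 <= k < p) (k%:R^-1) ^+ 2).
  by exists (d + y * c); [pint_tac | rewrite ed ec /P; ring].
rewrite /hsum1 mulr_sumr big_nat [X in eqmod _ _ _ X]big_nat.
apply: (big_ind2 (eqmod p 2)) => [|_ b1 _ b2 [c1 p1 ->] [c2 p2 ->]|k kp].
- by exists 0; [exact: rpred0 | ring].
- by exists (c1 + c2); [pint_tac | ring].
have [d pd ->] := hyp_sym_mulp pp py kp; have pV := pint_natV_lt pp kp.
by exists (d / k%:R); [pint_tac | ring].
Qed.

Lemma hsum2_mulp : eqmod p 1 (hsum2 p (P * y)) 0.
Proof.
suff H (s : seq nat) : eqmod p 1 (\sum_(k <- s | (0 < k < p)%N) hyp_sym (P * y) k / k%:R ^+ 2) 0.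
  by rewrite /hsum2 big_nat; apply: H.
apply: (big_ind (fun a => eqmod p 1 a 0)) => [|_ _ [c1 p1 ->] [c2 p2 ->]|k kp].
- by exists 0; [exact: rpred0 | ring].
- by exists (c1 + c2); [pint_tac | ring].
have [d pd ->] := hyp_sym_mulp pp py kp; have pV := pint_natV_lt pp kp.
exists (y * k%:R^-1 ^+ 3 + P * d * k%:R^-1 ^+ 2); first by rewrite /P; pint_tac.
by rewrite -exprVn /P; ring.
Qed.

Lemma mulp_shift1 a : P * y - a.+1%:R + 1 = P * y - a%:R.
Proof. by rewrite -natr1; ring. Qed.

(** At z = p y - (a+1) the product in [hsum1_diff] vanishes modulo p^2, so F(z) = F(z+1) + 2/z, the
    recursion of [harm]. *)
Lemma hsum1_shift a : (a < p)%N -> eqmod p 2 (hsum1 p (P * y - a%:R)) (harm a).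
Proof.
elim: a => [|a IH] ap; first by rewrite subr0 harm0; apply: hsum1_mulp.
have [|c pc ec] := IH _; first lia.
have [z0 zV] := unit_shift pp py (i := a.+1) ap.
have [d pd ed] := hyp_prod_shift (i := a.+1) ap.
have := @hsum1_diff p (P * y - a.+1%:R) (prime_gt0 pp); rewrite mulp_shift1 ec ed harmS.
set z := _ - _ in z0 zV *; move=> e; exists (c - 2 * d / z).
  by pint_tac.
have -> : hsum1 p z = harm a + P ^+ 2 * c - z * (harm a + P ^+ 2 * c - hsum1 p z) / z by field.
by rewrite e /P; field.
Qed.

(** With h = [harm a], one step subtracts (2 h + 2/z)/z, which completes h^2/2 to (h + 2/z)^2/2. *)
Lemma hsum2_shift a : (a < p)%N -> eqmod p 1 (hsum2 p (P * y - a%:R)) (- (2^-1 * harm a ^+ 2)).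
Proof.
elim: a => [|a IH] ap.
  have -> : - (2^-1 * harm 0 ^+ 2) = 0 by rewrite harm0; ring.
  by rewrite subr0; apply: hsum2_mulp.
have [|c pc ec] := IH _; first lia.
have [|d pd ed] := @hsum1_shift a; first lia.
have [f pf ef] := @hsum1_shift a.+1 ap.
have [z0 zV] := unit_shift pp py (i := a.+1) ap.
have := @hsum2_diff p (P * y - a.+1%:R) z0; rewrite mulp_shift1 ec ed ef harmS.
set z := _ - _ in z0 zV *; move=> e; exists (c - P * (d + f) / z).
  by rewrite /P; pint_tac.
have -> : hsum2 p z = - (2^-1 * harm a ^+ 2) + P ^+ 1 * c -
    z * (- (2^-1 * harm a ^+ 2) + P ^+ 1 * c - hsum2 p z) / z by field.
by rewrite e /P; field.
Qed.

(* The factor y (1 - y) is split off because it may itself be divisible by p;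
   the cofactor R is the rational number 1 - p Q_p(x). *)
Lemma hyp_sym_p_shift a : (a < p)%N -> exists2 R,
  hyp_sym (P * y - a%:R) p = y * (1 - y) * R &
  eqmod p 3 R (1 - P * harm a + 2^-1 * P ^+ 2 * harm a ^+ 2).
Proof.
have pgt0 := prime_gt0 pp.
have P0 : P != 0 by rewrite pnatr_eq0; lia.
have half := pint_half pp p3.
elim: a => [|a IH] ap.
  (* The first factor p y of (p y)_p and the last factor p (1-y) of (1 - p y)_p cancel the p^2 in
     p!^2. *)
  rewrite subr0; exists (hyp_prod (P * y) p.-1).
    have pS z : poch z p = poch z p.-1 * (z + p.-1%:R) by rewrite -pochS prednK.
    have pr : poch (P * y) p = P * y * poch (P * y + 1) p.-1.
      by rewrite -poch_recl prednK.
    rewrite /hyp_sym /hyp_prod pr !pS.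
    rewrite nat1r prednK; last lia.
    have eP : p.-1%:R = P - 1 by rewrite /P -[in RHS](prednK pgt0) -natr1 addrK.
    have -> : 1 - P * y + p.-1%:R = P * (1 - y) by rewrite eP; ring.
    rewrite [P * y + 1]addrC.
    have : poch 1 p.-1 != 0 by rewrite poch1 pnatr_eq0 -lt0n fact_gt0.
    by move=> q; rewrite -/P; field; rewrite P0 q.
  have [c pc ec] := sum_inv_sqr pp p3.
  have [|d pd ed] := @hyp_prod_mulp p y p.-1 pp py; first lia.
  rewrite prednK in ed; last lia.
  exists (d - y ^+ 2 * c); first by pint_tac.
  by rewrite ed ec harm0 /P; ring.
have [|R eR [c pc ec]] := IH _; first lia.
have [z0 zV] := unit_shift pp py (i := a.+1) ap.
have py1 : y + 1 \in pint p by pint_tac.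
have [zp0 zpV] := unit_shift pp py1 (i := a.+1) ap.
have ph : harm a \in pint p by apply: pint_harm; lia.
have e1 := mul_hyp_sym (P * y - a.+1%:R) p; have e2 := mul_hyp_symD1 (P * y - a.+1%:R) p.
rewrite mulp_shift1 eR in e2; rewrite harmS.
have ezp : P * (y + 1) - a.+1%:R = P * y - a.+1%:R + P by ring.
rewrite ezp in zp0 zpV.
set z := _ - _ in e1 e2 z0 zV zp0 zpV *; rewrite -/P in e1 e2.
(* Eliminating U_p(z) from the two relations gives T_p(z) = T_p(z+1) (z-p)/(z+p); here z + p = p
   (y+1) - (a+1) is a unit. *)
exists (R * (z - P) / (z + P)).
  apply: (mulfI z0); rewrite e1.
  have -> : hyp_opp z p = z * (y * (1 - y) * R) / (z + P) by rewrite e2; field.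
  by field.
rewrite ec.
(* With w = 1/z, (z - p) / (z + p) agrees with exp (- 2 p w) up to order p^3. *)
have -> : (1 - P * harm a + 2^-1 * P ^+ 2 * harm a ^+ 2 + p%:R ^+ 3 * c) * (z - P) / (z + P) =
  (1 - P * harm a + 2^-1 * P ^+ 2 * harm a ^+ 2 + P ^+ 3 * c) *
  (1 - 2 * P * z^-1 + 2 * P ^+ 2 * z^-1 ^+ 2 - 2 * P ^+ 3 * z^-1 ^+ 2 * (z + P)^-1).
  by rewrite -/P; field; rewrite z0 zp0.
pose w := z^-1; rewrite -/w in zV *; move: ((z + P)^-1) zpV => v vp.
(* The orders below p^3 collect to 1 - p (h+2w) + p^2 (h+2w)^2/2; the witness gathers the
   remainder. *)
exists (c * (1 - 2 * P * w + 2 * P ^+ 2 * w ^+ 2 - 2 * P ^+ 3 * w ^+ 2 * v)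
   - (1 - P * harm a + 2^-1 * P ^+ 2 * harm a ^+ 2) * 2 * w ^+ 2 * v
   - 2 * harm a * w ^+ 2 - harm a ^+ 2 * w + P * harm a ^+ 2 * w ^+ 2).
  by rewrite /P; pint_tac.
by rewrite -/P; field.
Qed.

End Chain.

(** * Residues of r/p and -r/p modulo m *)

Lemma modrepP (m p : nat) (s : int) : (0 < m)%N -> (0 < p)%N -> coprime m p ->
  (modrep m (s%:~R / p%:R) < m)%N /\
  (m%:Z %| s - (modrep m (s%:~R / p%:R))%:Z * p%:Z)%Z.
Proof.
move=> m0 p0 cmp; set a := s%:~R / p%:R.
have ea : numq a * p%:Z = s * denq a.
  apply/(@intr_inj rat); rewrite !rmorphM /= numqE /a -[p%:~R]/(p%:R).
  by field; rewrite pnatr_eq0; lia.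
have dp : (denq a %| p%:Z)%Z.
  have : (denq a %| numq a * p%:Z)%Z by rewrite ea dvdz_mull.
  by rewrite Gauss_dvdzr // coprimezE coprime_sym coprime_num_den.
have cmd : coprimez m%:Z (denq a).
  by rewrite coprimezE; apply: coprime_dvdr cmp; rewrite -(absz_nat p) -dvdzE.
rewrite /modrep; case: pickP => [t|none].
  rewrite -/a => mt; split; first exact: ltn_ord.
  rewrite -(Gauss_dvdzl _ cmd).
  have -> : (s - t%:Z * p%:Z) * denq a = (numq a - t%:Z * denq a) * p%:Z.
    by rewrite mulrBl -ea; ring.
  exact: dvdz_mulr.
(* The default case cannot occur: by Bezout, v inverts [denq a] modulo m, so [numq a * v] reduced
   modulo m is a representative. *)
have [[u v] /= uv] := coprimezP _ _ cmd.
have mz : m%:Z != 0 by lia.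
have b0 := modz_ge0 (numq a * v) mz.
have b1 : ((numq a * v) %% m%:Z < m%:Z)%Z by rewrite ltz_pmod //; lia.
have tm : (`|((numq a * v) %% m%:Z)%Z| < m)%N by lia.
have /negP[] := none (Ordinal tm); rewrite /= -/a gez0_abs //.
apply/dvdzP; exists (numq a * u + ((numq a * v) %/ m%:Z)%Z * denq a).
have := divz_eq (numq a * v) m%:Z; set q := divz _ _; set b := modz _ _ => e.
have -> : b = numq a * v - q * m%:Z by rewrite e; ring.
rewrite -[X in X - _]mulr1 -uv; ring.
Qed.

(** The two residues are positive, less than m, and sum to a multiple of m, hence to m. In p t = r +
    a m, r < m gives a >= 0 and t < m gives a < p. *)
Lemma modrep_opp (m p : nat) (r : nat) : (0 < r < m)%N -> (0 < p)%N -> coprime m p ->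
  let t := modrep m (r%:R / p%:R) in
  [/\ (0 < t < m)%N, modrep m (- (r%:R / p%:R)) = (m - t)%N &
      exists2 a, (a < p)%N & (p * t = r + a * m)%N].
Proof.
move=> rm p0 cmp t; have m0 : (0 < m)%N by lia.
have [tm] := modrepP r%:Z m0 p0 cmp.
have er : (r%:Z)%:~R = r%:R :> rat by [].
rewrite er -/t in tm * => /dvdzP[k ek].
have := modrepP (- r%:Z) m0 p0 cmp; rewrite mulrNz mulNr er.
set t' := modrep m _ => -[tm' /dvdzP[k' ek']].
have t0 : (0 < t)%N.
  rewrite lt0n; apply/eqP => t0; move: ek; rewrite t0 => ek.
  have : (k < 1) by nia.
  have : (0 < k) by nia.
  lia.
have mtt : (m %| t + t')%N.
  rewrite -(Gauss_dvdl _ cmp); apply/dvdnP; exists (absz (k + k')).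
  suff : (t + t')%:Z * p%:Z = - (k + k') * m%:Z by nia.
  by rewrite PoszD mulrDl; lia.
split; first by rewrite t0.
  have /dvdnP[[|[|n]] e] := mtt; nia.
have k1 : k < 1.
  rewrite ltNge; apply/negP => k1.
  have : m%:Z <= k * m%:Z by rewrite ler_peMl.
  have : 0 <= t%:Z * p%:Z by [].
  lia.
have eka : k = - (absz k)%:Z by lia.
move: (absz k) eka ek => a -> ek.
have e : (p * t = r + a * m)%N by lia.
exists a => //; rewrite ltnNge; apply/negP => pa.
have : (p * m <= a * m)%N by rewrite leq_mul2r pa orbT.
have : (p * t < p * m)%N by rewrite ltn_pmul2l.
lia.
Qed.

(** * Comparison of the sums with the Pochhammer quotient *)

Unset Implicit Arguments.

Theorem theorem3p1 (p r m : nat) :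
  prime p -> (3 < p)%N -> (0 < r)%N -> (r < m)%N -> coprime m p ->
  let x : rat := r%:R / m%:R in
  ratcong p 2
    (\sum_(1 <= k < p) poch x k * poch (1 - x) k / (poch 1 k) ^+ 2 / k%:R)
    (Qp p r m + 2^-1 * p%:R * (Qp p r m) ^+ 2)
  /\
  ratcong p 1
    (\sum_(1 <= k < p) poch x k * poch (1 - x) k / (poch 1 k) ^+ 2 / (k%:R ^+ 2))
    (- (2^-1 * (Qp p r m) ^+ 2)).
Proof.
move=> pp p3 r0 rm cmp x.
have p0 := prime_gt0 pp.
have rm' : (0 < r < m)%N by rewrite r0.
have [tm et [a ap epa]] := modrep_opp rm' p0 cmp.
rewrite -[X in ratcong p 2 X _]/(hsum1 p x) -[X in ratcong p 1 X _]/(hsum2 p x).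
have eQ : Qp p r m = p%:R^-1 * (1 - hyp_sym x p * ((m%:R) ^+ 2 /
    ((modrep m (r%:R / p%:R))%:R * (modrep m (- (r%:R / p%:R)))%:R))) by [].
rewrite et in eQ; move: (modrep _ _) tm epa eQ => t tm epa {et}.
rewrite natrB => [eQ|]; last lia.
have m0 : (m%:R : rat) != 0 by rewrite pnatr_eq0; lia.
have t0 : (t%:R : rat) != 0 by rewrite pnatr_eq0; lia.
have P0 : (p%:R : rat) != 0 by rewrite pnatr_eq0; lia.
have mt0 : m%:R - t%:R != 0 :> rat by rewrite subr_eq0 eqr_nat; lia.
pose y : rat := t%:R / m%:R.
have py : y \in pint p by rewrite rpredM ?rpred_nat // pint_natV // coprime_sym.
have ex : x = p%:R * y - a%:R.
  have e : p%:R * t%:R = r%:R + a%:R * m%:R :> rat by rewrite -!natrM epa natrD.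
  by rewrite /x /y mulrA e; field.
have half := pint_half pp p3; have ph := pint_harm pp p3 py ap.
have [R eR [c pc ec]] := hyp_sym_p_shift pp p3 py ap.
have [d pd ed] := hsum1_shift pp p3 py ap.
have [g pg eg] := hsum2_shift pp p3 py ap.
rewrite -ex in eR ed eg; move: (harm p y a) ph => H ph in ec ed eg *.
(* Chosen so that R = 1 - p H + p^2 k. *)
pose k := 2^-1 * H ^+ 2 + p%:R * c.
have {}eQ : Qp p r m = H - p%:R * k.
  (* The factor m^2/(t (m-t)) is 1/(y (1-y)), which is finite since 0 < t < m. *)
  have -> : Qp p r m = p%:R^-1 * (1 - R).
    by rewrite eQ eR /y; field; rewrite t0 m0 P0 mt0.
  by rewrite ec /k; field.
have pk : k \in pint p by rewrite /k; pint_tac.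
rewrite eQ ed eg; split.
  (* In Q + p Q^2/2 the terms p H^2/2 coming from -p k and from p Q^2/2 cancel. *)
  apply: (ratcongP (c := d + c + H * k - p%:R * 2^-1 * k ^+ 2)) => //.
    by pint_tac.
  by rewrite /k; field.
apply: (ratcongP (c := g - H * k + p%:R * 2^-1 * k ^+ 2)) => //.
  by pint_tac.
by field.
Qed.
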